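(* Let $\lambda,\mu,\nu\in\mathcal{P}_n$. If $l(\mu)+l(\nu)\leq n$, then $$\mathbf{B}_{n}^{\mathfrak{so}_{2n+1}}(\nu)_{\mu}^{\lambda}=\mathbf{B}_{n}^{\mathfrak{sp}_{2n}}(\nu)_{\mu}^{\lambda}.$$
   Context: $\mathcal{P}_n$ is the set of Young diagrams $\lambda=(\lambda_1\ge\dots\ge\lambda_n\ge0)$ with at most $n$ rows; $l(\lambda)$ is the number of nonzero rows. Positions in columns are counted from the top. The far-eastern reading $\mathrm{FE}(T)$ of a tableau is the sequence of its entries read from the rightmost column to the leftmost column, each column from top to bottom. **Adding letters.** For a letter $i\in\{1,\dots,n\}$, $\lambda[i]$ (resp. $\lambda[\bar i]$) is obtained from $\lambda$ by adding $1$ to (resp. subtracting $1$ from) $\lambda_i$. In type $B_n$ there is also the letter $0$: $\lambda[0]:=\lambda$ if $\lambda_n>0$, and $\lambda[0]:=(\lambda_1,\dots,\lambda_{n-1},-\infty)$ (not a Young diagram) if $\lambda_n=0$. $\lambda[m_1,\dots,m_k]:=\lambda[m_1,\dots,m_{k-1}][m_k]$. A sequence $m_1,\dots,m_N$ is smooth on a Young diagram $\lambda$ if $\lambda[m_1,\dots,m_k]$ is a Young diagram for all $k=1,\dots,N$. **Type $C_n$.** Letters $1\prec\cdots\prec n\prec\bar n\prec\cdots\prec\bar 1$. A $C_n$-semistandard tableau has weakly increasing rows and strictly increasing columns. It is KN-admissible if: (C1) whenever a column of length $N$ has $a\in\{1,\dots,n\}$ at position $p$ and $\bar b$ at position $q$,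 then $(q-p)+\max(a,b)>N$; (C2) whenever two adjacent columns (left, right) and $p\le q<r\le s$, $a_1\le b_1$, $a_2\le b_2$ in $\{1,\dots,n\}$ are such that either [left has $a_1$ at $p$; right has $b_1$ at $q$, $\overline{b_2}$ at $r$, $\overline{a_2}$ at $s$] or [left has $a_1$ at $p$, $b_1$ at $q$, $\overline{b_2}$ at $r$; right has $\overline{a_2}$ at $s$], then $(q-p)+(s-r)<\max(b_1,b_2)-\min(a_1,a_2)$. $\mathcal{B}^{\mathfrak{sp}_{2n}}(\nu)$ is the set of KN-admissible $C_n$-semistandard tableaux of shape $\nu$, and $\mathbf{B}_{n}^{\mathfrak{sp}_{2n}}(\nu)_{\mu}^{\lambda}$ is the set of $T\in\mathcal{B}^{\mathfrak{sp}_{2n}}(\nu)$ with $\mathrm{FE}(T)$ smooth on $\mu$ and $\mu[\mathrm{FE}(T)]=\lambda$. **Type $B_n$ (no spin columns).** Letters $1\prec\cdots\prec n\prec 0\prec\bar n\prec\cdots\prec\bar 1$. A $B_n$-tableau of shape $\nu\in\mathcal{P}_n$ (a filling by these letters) is semistandard if entries in each row are weakly increasing but $0$ is not repeated in a row, and entries in each column are strictly increasing except that $0$ may be repeated. It is KN-admissible if: (B1) whenever a column of length $N$ has $i\in\{1,\dots,n\}$ at position $p$ and $\bar i$ at position $q$, then $(q-p)+i>N$. (B2) whenever two adjacent columns and $p\le q<r\le s$, $a\le b<n$ are such that either [left has $a$ at $p$; right has $b$ at $q$, $\bar b$ at $r$, $\bar a$ at $s$] or [left has $a$ at $p$, $b$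 at $q$, $\bar b$ at $r$; right has $\bar a$ at $s$], then $(q-p)+(s-r)<b-a$. (B3) whenever two adjacent columns, $p\le q<r=q+1\le s$ and $a<n$ are such that, for some $(u,v)\in\{(n,\bar n),(n,0),(0,0),(0,\bar n)\}$, either [left has $a$ at $p$; right has $u$ at $q$, $v$ at $r$, $\bar a$ at $s$] or [left has $a$ at $p$, $u$ at $q$, $v$ at $r$; right has $\bar a$ at $s$], then $(q-p)+(s-r)=s-p-1<n-a$. (B4) there are no two adjacent columns and $p<s$ such that the left column has $u$ at position $p$ and the right column has $v$ at position $s$ with $(u,v)\in\{(n,\bar n),(n,0),(0,0),(0,\bar n)\}$. $\mathcal{B}^{\mathfrak{so}_{2n+1}}(\nu)$ is the set of KN-admissible semistandard $B_n$-tableaux of shape $\nu$, and $\mathbf{B}_{n}^{\mathfrak{so}_{2n+1}}(\nu)_{\mu}^{\lambda}$ is the set of $T\in\mathcal{B}^{\mathfrak{so}_{2n+1}}(\nu)$ with $\mathrm{FE}(T)$ smooth on $\mu$ and $\mu[\mathrm{FE}(T)]=\lambda$. The equality in the claim is equality of sets of fillings of $\nu$. *)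

(* Defs.v *)
From mathcomp Require Import all_boot all_order all_algebra.
From mathcomp Require Import classical_sets.

Set Implicit Arguments.
Unset Strict Implicit.
Unset Printing Implicit Defensive.

Local Open Scope classical_set_scope.
Local Open Scope nat_scope.

Record young (n : nat) : Type := Young {
  rows :> n.-tuple nat;
  rows_sorted : sorted geq rows
}.

Definition ell (n : nat) (nu : young n) : nat := count (fun x => 0 < x) nu.

Definition col_lengths (n : nat) (nu : young n) : seq nat :=
  [seq count (fun x => j < x) nu | j <- iota 0 (head 0 nu)].

(* The letters of type B_n; those of type C_n are the letters other than Zero.
   Ordinals start at 0, so Pos i is the letter i.+1 and Neg i is its barred
   counterpart. *)
Inductive letter (n : nat) : Type :=
  | Pos of 'I_n
  | Zero
  | Neg of 'I_n.
Arguments Zero {n}.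

Definition is_zero (n : nat) (x : letter n) : bool :=
  if x is Zero then true else false.

(* Position of a letter in 1 < ... < n < 0 < \bar n < ... < \bar 1, counted
   from 0. *)
Definition rank (n : nat) (x : letter n) : nat :=
  match x with
  | Pos i => i
  | Zero => n
  | Neg i => n.*2 - i
  end.

Definition ltl (n : nat) : rel (letter n) := fun x y => rank x < rank y.
Definition lel (n : nat) : rel (letter n) := fun x y => rank x <= rank y.

(* Vectors with entries in Z together with -oo, the latter encoded by None. *)
Definition weight (n : nat) : Type := {ffun 'I_n -> option int}.

Definition weight_of (n : nat) (la : young n) : weight n :=
  [ffun i => Some (Posz (tnth la i))].

Definition is_young (n : nat) (w : weight n) : Prop :=
  exists la : young n, w = weight_of la.

(* For Zero, the last entry becomes -oo unless it is positive; on a Young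
   diagram this means exactly when it is 0. *)
Definition add_letter (n : nat) (w : weight n) (m : letter n) : weight n :=
  match m with
  | Pos i =>
      [ffun j : 'I_n =>
         if j == i then omap (fun z => z + 1)%R (w j) else w j]
  | Neg i =>
      [ffun j : 'I_n =>
         if j == i then omap (fun z => z - 1)%R (w j) else w j]
  | Zero =>
      [ffun j : 'I_n =>
         if j.+1 == n
         then if w j is Some z then if (0 < z)%R then w j else None else None
         else w j]
  end.

Definition add_letters (n : nat) (w : weight n) (s : seq (letter n)) :
    weight n :=
  foldl (@add_letter n) w s.

Definition smooth (n : nat) (la : young n) (s : seq (letter n)) : Prop :=
  forall k, 0 < k <= size s -> is_young (add_letters (weight_of la) (take k s)).

(* A filling is the sequence of its columns, from left to right, each column
   being read from top to bottom. *)
Definition tableau (n : nat) : Type := seq (seq (letter n)).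

Definition has_shape (n : nat) (nu : young n) (T : tableau n) : Prop :=
  [seq size c | c <- T] = col_lengths nu.

Definition tab_row (n : nat) (T : tableau n) (i : nat) : seq (letter n) :=
  pmap (fun c => onth c i) T.

Definition FE (n : nat) (T : tableau n) : seq (letter n) := flatten (rev T).

(* Positions are counted from 0; every condition below only involves
   differences of positions. *)
Definition entry (n : nat) (c : seq (letter n)) (p : nat) (x : letter n) :
    Prop :=
  onth c p = Some x.

Definition column (n : nat) (T : tableau n) (c : seq (letter n)) : Prop :=
  exists j, onth T j = Some c.

Definition adjacent (n : nat) (T : tableau n) (L R : seq (letter n)) : Prop :=
  exists j, onth T j = Some L /\ onth T j.+1 = Some R.

Definition config (n : nat) (L R : seq (letter n)) (p q r s : nat)
    (x y z t : letter n) : Prop :=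
  [/\ entry L p x, entry R q y, entry R r z & entry R s t] \/
  [/\ entry L p x, entry L q y, entry L r z & entry R s t].

Definition C_semistandard (n : nat) (T : tableau n) : Prop :=
  [/\ forall c, column T c -> all (fun x => ~~ is_zero x) c,
      forall i, sorted (@lel n) (tab_row T i)
    & forall c, column T c -> sorted (@ltl n) c].

(* In a column with strictly increasing entries the barred letters are below
   the unbarred ones, so q - p below is never truncated. *)
Definition C1 (n : nat) (T : tableau n) : Prop :=
  forall c (a b : 'I_n) (p q : nat), column T c ->
    entry c p (Pos a) -> entry c q (Neg b) ->
    (q - p) + maxn a.+1 b.+1 > size c.

Definition C2 (n : nat) (T : tableau n) : Prop :=
  forall L R (p q r s : nat) (a1 b1 a2 b2 : 'I_n), adjacent T L R ->
    p <= q -> q < r -> r <= s -> a1 <= b1 -> a2 <= b2 ->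
    config L R p q r s (Pos a1) (Pos b1) (Neg b2) (Neg a2) ->
    (q - p) + (s - r) < maxn b1.+1 b2.+1 - minn a1.+1 a2.+1.

Definition C_admissible (n : nat) (T : tableau n) : Prop := C1 T /\ C2 T.

Definition B_sp (n : nat) (nu : young n) : set (tableau n) :=
  [set T | [/\ has_shape nu T, C_semistandard T & C_admissible T]].

Definition B_sp_smooth (n : nat) (nu mu la : young n) : set (tableau n) :=
  [set T | [/\ B_sp nu T, smooth mu (FE T)
              & add_letters (weight_of mu) (FE T) = weight_of la]].

Definition B_semistandard (n : nat) (T : tableau n) : Prop :=
  [/\ forall i, sorted (@lel n) (tab_row T i),
      forall i, count (@is_zero n) (tab_row T i) <= 1
    & forall c, column T c ->
        sorted (fun x y : letter n => ltl x y || (is_zero x && is_zero y)) c].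

Definition central_pair (n : nat) (u v : letter n) : Prop :=
  exists k : 'I_n, k.+1 = n /\
    [\/ (u, v) = (Pos k, Neg k), (u, v) = (Pos k, Zero),
        (u, v) = (Zero, Zero) | (u, v) = (Zero, Neg k)].

Definition B1 (n : nat) (T : tableau n) : Prop :=
  forall c (i : 'I_n) (p q : nat), column T c ->
    entry c p (Pos i) -> entry c q (Neg i) ->
    (q - p) + i.+1 > size c.

Definition B2 (n : nat) (T : tableau n) : Prop :=
  forall L R (p q r s : nat) (a b : 'I_n), adjacent T L R ->
    p <= q -> q < r -> r <= s -> a <= b -> b.+1 < n ->
    config L R p q r s (Pos a) (Pos b) (Neg b) (Neg a) ->
    (q - p) + (s - r) < b.+1 - a.+1.

Definition B3 (n : nat) (T : tableau n) : Prop :=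
  forall L R (p q r s : nat) (a : 'I_n) (u v : letter n), adjacent T L R ->
    p <= q -> r = q.+1 -> r <= s -> a.+1 < n -> central_pair u v ->
    config L R p q r s (Pos a) u v (Neg a) ->
    (q - p) + (s - r) < n - a.+1.

Definition B4 (n : nat) (T : tableau n) : Prop :=
  forall L R (p s : nat) (u v : letter n), adjacent T L R ->
    p < s -> central_pair u v -> ~ (entry L p u /\ entry R s v).

Definition B_admissible (n : nat) (T : tableau n) : Prop :=
  [/\ B1 T, B2 T, B3 T & B4 T].

Definition B_so (n : nat) (nu : young n) : set (tableau n) :=
  [set T | [/\ has_shape nu T, B_semistandard T & B_admissible T]].

Definition B_so_smooth (n : nat) (nu mu la : young n) : set (tableau n) :=
  [set T | [/\ B_so nu T, smooth mu (FE T)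
              & add_letters (weight_of mu) (FE T) = weight_of la]].

(* Main.v *)
(* While FE(T) is read, smoothness lets the current diagram grow by at most one
   row per unbarred letter of the column being read, and the weakly increasing
   rows prevent these gains from accumulating over columns: after reading a
   column with U unbarred letters the diagram has at most l(mu) + U rows. When
   [0] or barred [n] is read the column contains a letter that is not unbarred,
   so the diagram has at most l(mu) + l(nu) - 1 < n rows and the result is not a
   Young diagram. Hence neither letter occurs, (B3) and (B4) are vacuous, and it
   remains to see that the one-letter conditions (B1), (B2) imply the two-letter
   conditions (C1), (C2); this follows by taking a minimal violation of a
   counting form of the latter. *)
Require Import Defs.
From mathcomp Require Import all_boot all_order all_algebra.
From mathcomp Require Import classical_sets.
From mathcomp Require Import zify.

Set Implicit Arguments.
Unset Strict Implicit.
Unset Printing Implicit Defensive.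

(** * Counting functions of columns *)

Definition nbelow (n : nat) (c : seq (letter n)) (t : nat) : nat :=
  count (fun x => rank x < t) c.

Lemma ltn_nth_count (s : seq nat) (p t : nat) :
  sorted leq s -> p < size s ->
  (nth 0 s p < t) = (p < count (fun x => x < t) s).
Proof.
elim: s p => [|x s IHs] // p s_sorted p_lt.
have count0 : t <= x -> count (fun y => y < t) s = 0.
  move=> t_le_x; apply/eqP; rewrite eqn0Ngt -has_count; apply/hasPn => y ys.
  rewrite -leqNgt (leq_trans t_le_x)//.
  exact: (allP (order_path_min leq_trans s_sorted)).
case: p p_lt => [_|p p_lt] /=.
  by case: (ltnP x t) => // /count0 ->.
rewrite IHs ?(path_sorted s_sorted)//; case: (ltnP x t) => [_|/count0 ->]; lia.
Qed.

Lemma rank_inj n : injective (@rank n).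
Proof.
have [ltP leP] : (forall i : 'I_n, i < n) /\ (forall i : 'I_n, n < n.*2 - i).
  by split=> i; have := ltn_ord i; lia.
case=> [i||i] [j||j] //= e.
- by congr Pos; apply: val_inj.
- by move: (ltP i); lia.
- by move: (ltP i) (leP j); lia.
- by move: (ltP j); lia.
- by move: (leP j); lia.
- by move: (leP i) (ltP j); lia.
- by move: (leP i); lia.
- by congr Neg; apply: val_inj; move: (leP i) (leP j) => /=; lia.
Qed.

Lemma entry_rank n (c : seq (letter n)) p x :
  entry c p x <-> p < size c /\ nth 0 (map (@rank n) c) p = rank x.
Proof.
rewrite /entry; elim: c p => [|y c IHc] [|p] /=; try by split=> [//|[]].
  by split=> [[->]|[_ /rank_inj ->]].
exact: IHc.
Qed.

Lemma nbelow_map n (c : seq (letter n)) t :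
  nbelow c t = count (fun k => k < t) (map (@rank n) c).
Proof. by rewrite count_map. Qed.

Lemma nbelow_le n (c : seq (letter n)) t u :
  t <= u -> nbelow c t <= nbelow c u.
Proof. by move=> tu; apply: sub_count => x /= /leq_trans; apply. Qed.

Lemma nbelow_size n (c : seq (letter n)) t : nbelow c t <= size c.
Proof. exact: count_size. Qed.

Lemma nbelow_full n (c : seq (letter n)) : nbelow c n.*2.+1 = size c.
Proof.
rewrite /nbelow -(count_predT c); apply: eq_count => -[i||i] /=.
- by move: (ltn_ord i); lia.
- by lia.
- by lia.
Qed.

Lemma nbelowS n (c : seq (letter n)) t :
  sorted (@ltl n) c -> nbelow c t.+1 <= (nbelow c t).+1.
Proof.
move=> c_sorted; have c_uniq : uniq (map (@rank n) c).
  by apply: (sorted_uniq ltn_trans ltnn); rewrite sorted_map.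
rewrite !nbelow_map -[leqRHS]addn1.
apply: (@leq_trans (count (fun k => k < t) (map (@rank n) c) +
                    count_mem t (map (@rank n) c))); last first.
  by rewrite leq_add2l count_uniq_mem// leq_b1.
rewrite -count_predUI; apply: leq_trans (leq_addr _ _).
by apply: sub_count => k /=; rewrite ltnS leq_eqVlt orbC.
Qed.

Lemma ltl_lel_sorted n (c : seq (letter n)) :
  sorted (@ltl n) c -> sorted (@lel n) c.
Proof. by apply: sub_sorted => x y; apply: ltnW. Qed.

Lemma ltn_rank_entry n (c : seq (letter n)) p x t :
  sorted (@lel n) c -> entry c p x -> (rank x < t) = (p < nbelow c t).
Proof.
move=> cs /entry_rank[p_lt <-]; rewrite nbelow_map.
by rewrite ltn_nth_count ?size_map// sorted_map.
Qed.

(** Turns the position of a letter into a unit jump of the counting function, so that admissibility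
    becomes a matter of linear inequalities. *)
Lemma entryP n (c : seq (letter n)) p x : sorted (@ltl n) c ->
  entry c p x <-> nbelow c (rank x) = p /\ nbelow c (rank x).+1 = p.+1.
Proof.
move=> cs; have cw := ltl_lel_sorted cs; split.
  move=> e; have := ltn_rank_entry (rank x) cw e.
  have := ltn_rank_entry (rank x).+1 cw e.
  by have := nbelowS (rank x) cs; lia.
case=> e1 e2; apply/entry_rank; have p_lt : p < size c.
  by rewrite -e2 nbelow_size.
split=> //.
have cm : sorted leq (map (@rank n) c) by rewrite sorted_map.
have := @ltn_nth_count _ p (rank x) cm; have := @ltn_nth_count _ p (rank x).+1 cm.
rewrite size_map -!nbelow_map e1 e2 => /(_ p_lt) + /(_ p_lt); lia.
Qed.

(** * From one-letter to two-letter admissibility *)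

Lemma C1_of_B1 n (T : tableau n) :
  (forall c, column T c -> sorted (@ltl n) c) -> B1 T -> C1 T.
Proof.
move=> col_sorted b1 c a b p q cT; have cs := col_sorted c cT.
move=> /(entryP _ _ cs) /= [ea ea'] /(entryP _ _ cs) /= [eb eb'].
rewrite ltnNge; apply/negP => viol.
(* The number of letters of absolute value at most [m] is at most [m]: the least
   [m] at which this fails occurs together with its bar, against [B1]. *)
suff no_excess m : m <= n ->
    size c + nbelow c m <= nbelow c (n.*2 - m).+1 + m.
  have m_lt : (maxn a b).+1 <= n by rewrite gtn_max !ltn_ord.
  have := no_excess _ m_lt; have := @nbelow_le _ c a.+1 (maxn a b).+1.
  have := @nbelow_le _ c (n.*2 - (maxn a b).+1).+1 (n.*2 - b).
  have := @nbelow_le _ c a (n.*2 - b).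
  by have := ltn_ord a; have := ltn_ord b; lia.
elim: m => [|m IHm] m_lt.
  by rewrite subn0 nbelow_full /nbelow (eq_count (a2 := pred0)) ?count_pred0.
have := IHm (ltnW m_lt).
have -> : (n.*2 - m.+1).+1 = n.*2 - m by lia.
have := nbelowS m cs; have := nbelowS (n.*2 - m) cs.
have := @nbelow_le _ c m (n.*2 - m).
have := b1 c (Ordinal m_lt) _ _ cT.
move=> /(_ (nbelow c m) (nbelow c (n.*2 - m))).
rewrite (entryP _ _ cs) (entryP _ _ cs) /=.
lia.
Qed.

(* In [C2] and [B2], [F], [G] and [H] are the counting functions of the left
   column, of the column containing the two middle letters, and of the right
   column. As long as [B] and its bar are not both in the middle column, [B]
   can be decreased, and as long as [A] is not in the left column together with
   its bar in the right one, [A] can be increased. *)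
Lemma minimal_violation (n : nat) (F G H : nat -> nat) (A B : nat) :
  (forall t, [/\ F t <= F t.+1 <= (F t).+1, G t <= G t.+1 <= (G t).+1
                & H t <= H t.+1 <= (H t).+1]) ->
  (forall t, H t <= G t <= F t) ->
  A <= B < n ->
  G (n.*2 - B) + F A + (B - A) + 2 <= G B.+1 + H (n.*2 - A).+1 ->
  exists a b, [/\ A <= a <= b, b <= B,
    F a.+1 = (F a).+1 /\ H (n.*2 - a).+1 = (H (n.*2 - a)).+1,
    G b.+1 = (G b).+1 /\ G (n.*2 - b).+1 = (G (n.*2 - b)).+1 &
    G (n.*2 - b) + F a + (b - a) <= G b + H (n.*2 - a)].
Proof.
move=> step HGF; have [k] := ubnP (B - A).
elim: k A B => // k IHk A B ltk /andP[AB Bn] viol.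
have [sFA sGA _] := step A.
have [_ sGA' sHA'] := step (n.*2 - A).
have [_ sGB _] := step B; have [_ sGB' _] := step (n.*2 - B).
have [eqAB|neqAB] := eqVneq A B.
  (* The sandwich [H <= G <= F] leaves no slack: [viol] is an equality and forces all four jumps. *)
  subst B; exists A, A.
  by have := HGF A; have := HGF A.+1; have := HGF (n.*2 - A);
    have := HGF (n.*2 - A).+1; split; lia.
have [inB|notinB] := boolP ((G B.+1 == (G B).+1) &&
                            (G (n.*2 - B).+1 == (G (n.*2 - B)).+1)); last first.
  (* Lowering [B] loses at most one jump of [G], which the drop of [B - A] by one repays; raising
     [A] below is symmetric. *)
  case: B => [|B] in AB Bn viol ltk neqAB sGB sGB' notinB *; first by lia.
  have eB : (n.*2 - B.+1).+1 = n.*2 - B by lia.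
  rewrite eB in sGB' notinB.
  by have [|||a [b [h1 h2 h3 h4 h5]]] := IHk A B; [lia..|exists a, b; split=> //; lia].
have [inA|notinA] := boolP ((F A.+1 == (F A).+1) &&
                            (H (n.*2 - A).+1 == (H (n.*2 - A)).+1)); last first.
  have eA : (n.*2 - A.+1).+1 = n.*2 - A by lia.
  have [|||a [b [h1 h2 h3 h4 h5]]] := IHk A.+1 B; rewrite ?eA; [lia..|].
  by exists a, b; split=> //; lia.
by exists A, B; split; lia.
Qed.

(** Lets both kinds of configuration be treated at once, through the column [M] of the two middle
    letters. *)
Lemma config_middle n (L R : seq (letter n)) p q r s x y z t :
  config L R p q r s x y z t <->
  exists2 M, M = L \/ M = R &
    [/\ entry L p x, entry M q y, entry M r z & entry R s t].
Proof.
split=> [[h|h]|[M [->|->] h]]; [exists R|exists L|right|left] => //.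
  by right.
by left.
Qed.

Lemma C2_of_B2 n (T : tableau n) :
  (forall c, column T c -> sorted (@ltl n) c) ->
  (forall L R t, adjacent T L R -> nbelow R t <= nbelow L t) ->
  (forall c p (b : 'I_n), column T c -> entry c p (Neg b) -> b.+1 < n) ->
  B2 T -> C2 T.
Proof.
move=> col_sorted row_sorted no_neg_n b2 L R p q r s a1 b1 a2 b2b LR.
move=> pq qr rs ab1 ab2 /config_middle[M ML].
have colL : column T L by case: LR => j [? ?]; exists j.
have colR : column T R by case: LR => j [? ?]; exists j.+1.
have colM : column T M by case: ML => ->.
have [Ls Rs Ms] := And3 (col_sorted L colL) (col_sorted R colR) (col_sorted M colM).
have sandwich t : nbelow R t <= nbelow M t <= nbelow L t.
  by have := row_sorted L R t LR; case: ML => ->; rewrite leqnn => ->.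
case=> /(entryP _ _ Ls) /= [ep ep'] /(entryP _ _ Ms) /= [eq eq'].
move=> /(entryP _ _ Ms) /= [er er'] /(entryP _ _ Rs) /= [es es'].
rewrite ltnNge; apply/negP => viol.
(* Monotonicity of the counting functions moves the violation from the four given letters to this
   outer pair. *)
have [] := @minimal_violation n (nbelow L) (nbelow M) (nbelow R)
  (minn a1 a2) (maxn b1 b2b).
- by move=> t; rewrite !nbelow_le ?nbelowS.
- exact: sandwich.
- by have := ltn_ord b1; have := ltn_ord b2b; lia.
- have aL := nbelow_le L (geq_minl a1 a2).
  have bM := nbelow_le M (leq_maxl b1 b2b : b1.+1 <= (maxn b1 b2b).+1).
  have bM' := nbelow_le M (leq_sub2l n.*2 (leq_maxr b1 b2b)).
  have aR := nbelow_le R (leq_sub2l n.*2 (geq_minr a1 a2) :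
               (n.*2 - a2).+1 <= (n.*2 - minn a1 a2).+1).
  lia.
move=> a [b [/andP[_ ab] bB [ea ea'] [eb eb'] viol']].
have bn : b < n by have := ltn_ord b1; have := ltn_ord b2b; lia.
have an : a < n by lia.
pose bo := Ordinal bn; pose ao := Ordinal an.
have MNb : entry M (nbelow M (n.*2 - b)) (Neg bo) by apply/entryP.
(* [B2] is silent on the letter [n], but here [n] would come with its bar, which does not occur. *)
have bn1 : b.+1 < n := no_neg_n M _ bo colM MNb.
have := @nbelow_le _ M b.+1 (n.*2 - b).
have := @nbelow_le _ M b (n.*2 - b).
(* With [viol'] and [sandwich], this bound puts the new positions in the order that [B2] requires,
   so no subtraction truncates. *)
have growth (c : seq (letter n)) t d : sorted (@ltl n) c ->
    nbelow c (t + d) <= nbelow c t + d.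
  move=> cs; elim: d => [|d IHd]; first by rewrite !addn0.
  by have := nbelowS (t + d) cs; rewrite !addnS; lia.
have := growth M a (b - a) Ms; have := growth M (n.*2 - b) (b - a) Ms.
have -> : n.*2 - b + (b - a) = n.*2 - a by lia.
have -> : a + (b - a) = b by lia.
have := sandwich a; have := sandwich (n.*2 - a).
move=> h1 h2 h3 h4 h5 h6.
have := b2 L R (nbelow L a) (nbelow M b) (nbelow M (n.*2 - b))
  (nbelow R (n.*2 - a)) ao bo LR.
move=> H.
have : nbelow M b - nbelow L a + (nbelow R (n.*2 - a) - nbelow M (n.*2 - b)) <
       b.+1 - a.+1.
  apply: H => //; try lia.
  by apply/config_middle; exists M => //; split; apply/entryP.
lia.
Qed.

(** * Number of rows while letters are read *)

Lemma young_weight n (w : weight n) : is_young w ->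
  exists2 f : 'I_n -> nat, forall i, w i = Some (Posz (f i)) &
    forall i j : 'I_n, i <= j -> f j <= f i.
Proof.
case=> la ->; exists (tnth la) => [i|i j ij]; first by rewrite ffunE.
rewrite !(tnth_nth 0).
have geq_trans : transitive geq by move=> ? ? ? /= /[swap]; apply: leq_trans.
apply: (sorted_leq_nth geq_trans leqnn 0 (rows_sorted la)) => //;
  by rewrite inE size_tuple.
Qed.

Definition length_le n (w : weight n) (M : nat) : Prop :=
  forall j : 'I_n, M <= j -> w j = Some 0%R.

Lemma length_leW n (w : weight n) M M' :
  M <= M' -> length_le w M -> length_le w M'.
Proof. by move=> MM' wM j M'j; apply: wM; apply: leq_trans M'j. Qed.

Lemma nth_nonincreasing_eq0 (s : seq nat) k :
  sorted geq s -> count (fun x => 0 < x) s <= k -> nth 0 s k = 0.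
Proof.
have geq_trans : transitive geq by move=> ? ? ? /= /[swap]; apply: leq_trans.
elim: s k => [|x s IHs] k; first by rewrite nth_nil.
case: x => [|x] /= s_sorted.
  case: k => //= k _; have [k_lt|] := ltnP k (size s); last exact: nth_default.
  have /allP/(_ _ (mem_nth 0 k_lt)) := order_path_min geq_trans s_sorted.
  by rewrite /= leqn0 => /eqP.
by case: k => //= k; rewrite add1n ltnS; apply: IHs; apply: path_sorted s_sorted.
Qed.

Lemma weight_of_length n (mu : young n) : length_le (weight_of mu) (ell mu).
Proof.
move=> j mu_j; rewrite ffunE (tnth_nth 0).
by rewrite (nth_nonincreasing_eq0 (rows_sorted mu)).
Qed.

(** For [i > M] the entries at [i.-1] and [i] are both 0 and would become 0, 1, which no diagram
    allows. *)
Lemma add_Pos_length n (w : weight n) M (i : 'I_n) :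
  is_young (add_letter w (Pos i)) -> length_le w M ->
  i <= M /\ length_le (add_letter w (Pos i)) (maxn M i.+1).
Proof.
move=> /young_weight[f fE f_mono] wM; split.
  rewrite leqNgt; apply/negP => Mi.
  have i1n : i.-1 < n by have := ltn_ord i; lia.
  have := fE i; have := fE (Ordinal i1n); rewrite !ffunE eqxx.
  rewrite (wM i) ?(ltnW Mi)// (wM (Ordinal i1n)) /=; last by lia.
  have -> : (Ordinal i1n == i) = false.
    by apply/negbTE/eqP => /(congr1 val) /=; lia.
  have := @f_mono (Ordinal i1n) i; rewrite /= leq_pred => /(_ isT).
  by move=> h [e1] [e2]; lia.
move=> j; rewrite geq_max => /andP[Mj ij]; rewrite ffunE ifN ?wM//.
by rewrite -val_eqE /=; lia.
Qed.

(** The last entry is 0, so [Zero] would turn it into -oo; [Neg i] with [M <= i] would create -1.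
    Hence [i < M < n], so [i] is at most n - 2 and its bar has rank at least n + 2. *)
Lemma add_nonPos_length n (w : weight n) M (x : letter n) :
  is_young (add_letter w x) -> length_le w M -> M < n -> n <= rank x ->
  n.+1 < rank x /\ length_le (add_letter w x) M.
Proof.
move=> /young_weight[f fE _] wM Mn.
case: x fE => [i||i] fE /=; first by rewrite leqNgt ltn_ord.
  have n1n : n.-1 < n by lia.
  have := fE (Ordinal n1n); rewrite ffunE /= wM /=; last by lia.
  by rewrite prednK ?eqxx//; lia.
move=> _; have iM : i < M.
  rewrite ltnNge; apply/negP => Mi.
  by have := fE i; rewrite ffunE eqxx wM.
split; first by lia.
by move=> j Mj; rewrite ffunE ifN ?wM// -val_eqE /=; lia.
Qed.

Lemma entry_exists n (c : seq (letter n)) p : p < size c -> exists x, entry c p x.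
Proof. by rewrite -onthTE /entry; case: (onth c p) => // x _; exists x. Qed.

Lemma add_letters_take n (w : weight n) (c : seq (letter n)) k x :
  entry c k x ->
  add_letters w (take k.+1 c) = add_letter (add_letters w (take k c)) x.
Proof.
rewrite /entry => e; have k_lt : k < size c by rewrite -onthTE e.
by rewrite (take_nth x)// (onth_nth x _ _ _ e) /add_letters foldl_rcons.
Qed.

(* A diagram of at most [K + U0] rows becomes one of at most
   [K + max U0 (min k (nbelow c n))] rows after the first [k] letters of [c],
   since an unbarred letter lengthens it by at most one row and a barred one
   does not lengthen it. When the unbarred letters are exhausted this number is
   smaller than [n], which is too short for reading [0] or barred [n]. *)
Lemma column_length n (w : weight n) (K U0 : nat) (c : seq (letter n)) :
  sorted (@lel n) c ->
  (forall k, 0 < k <= size c -> is_young (add_letters w (take k c))) ->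
  length_le w (K + U0) -> U0 <= nbelow c (K + U0) -> K + size c <= n ->
  [/\ forall p x, entry c p x -> rank x < n \/ n.+1 < rank x,
      length_le (add_letters w c) (K + nbelow c n) &
      nbelow c n <= nbelow c (K + nbelow c n)].
Proof.
move=> cs young_take w_len U0_le size_le; set U1 := nbelow c n.
have U0_size : U0 <= size c := leq_trans U0_le (nbelow_size _ _).
have U0U1 : U0 <= U1 by apply: leq_trans U0_le _; apply: nbelow_le; lia.
have U1_size : U1 <= size c := nbelow_size _ _.
have main k : k <= size c ->
    length_le (add_letters w (take k c)) (K + maxn U0 (minn k U1)) /\
    forall p x, p < k -> entry c p x -> rank x < K + U1 <= n \/ n.+1 < rank x.
  elim: k => [_|k IHk k_lt].
    by split=> //; rewrite take0 min0n maxn0.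
  have [k_len k_letters] := IHk (ltnW k_lt).
  have [y cy] := entry_exists k_lt.
  have := young_take k.+1 k_lt; rewrite (add_letters_take _ cy) => y_young.
  suff [y_len y_letter] : length_le (add_letter (add_letters w (take k c)) y)
      (K + maxn U0 (minn k.+1 U1)) /\ (rank y < K + U1 <= n \/ n.+1 < rank y).
    split=> // p x; rewrite ltnS leq_eqVlt => /predU1P[->|]; last exact: k_letters.
    by rewrite /entry in cy *; rewrite cy => -[<-].
  have [y_pos|y_nonpos] := ltnP (rank y) n; last first.
    have U1k : U1 <= k by rewrite leqNgt -(ltn_rank_entry n cs cy) -leqNgt.
    have eM : maxn U0 (minn k.+1 U1) = maxn U0 (minn k U1) by lia.
    have [||] := add_nonPos_length y_young k_len => //; first by lia.
    by rewrite eM; split=> //; right.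
  have kU1 : k < U1 by rewrite -(ltn_rank_entry n cs cy).
  case: y cy y_young y_pos => [i||i] cy y_young /= y_pos; [|by lia|by have := ltn_ord i; lia].
  have [i_le i_len] := add_Pos_length y_young k_len.
  (* The first [U0] letters stay within the rows already allowed for; this is what keeps the gains
     of successive columns from adding up. *)
  have i_lt : k < U0 -> i < K + U0.
    by move=> kU0; rewrite (ltn_rank_entry (K + U0) cs cy); lia.
  split; last by left; lia.
  by apply: length_leW i_len; lia.
have [] := main _ (leqnn _); rewrite take_size => c_len c_letters; split.
- move=> p x cx; have p_lt : p < size c by rewrite -onthTE cx.
  by case: (c_letters p x p_lt cx); [left; lia|right].
- by apply: length_leW c_len; lia.
have [->//|U1_gt0] := posnP U1.
(* The last unbarred letter has the largest rank among the [U1] of them, so bounding it suffices. *)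
have [|x cx] := @entry_exists _ c U1.-1; first by lia.
have x_pos : rank x < n by rewrite (ltn_rank_entry n cs cx) -/U1; lia.
have [||] := c_letters _ x _ cx; [lia| |lia].
by rewrite (ltn_rank_entry (K + U1) cs cx); lia.
Qed.

(** * Reading a whole tableau *)

Lemma FE_cons n (c : seq (letter n)) (T : tableau n) : FE (c :: T) = FE T ++ c.
Proof. by rewrite /FE rev_cons flatten_rcons. Qed.

(** Induction on columns, the tail being read before the head. The invariant is the pair of
    conclusions of [column_length] with [K = ell mu]; comparison of adjacent columns hands it on to
    the next column. *)
Lemma smooth_letters n (mu : young n) (T : tableau n) :
  (forall c, column T c -> sorted (@lel n) c) ->
  (forall L R t, adjacent T L R -> nbelow R t <= nbelow L t) ->
  (forall c, column T c -> ell mu + size c <= n) ->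
  smooth mu (FE T) ->
  forall c p x, column T c -> entry c p x -> rank x < n \/ n.+1 < rank x.
Proof.
move=> cs rs size_le T_smooth.
suff [] : (forall c p x, column T c -> entry c p x ->
      rank x < n \/ n.+1 < rank x) /\
    exists2 U, length_le (add_letters (weight_of mu) (FE T)) (ell mu + U) &
      U <= nbelow (head [::] T) (ell mu + U) by [].
elim: T => [|c T IHT] in cs rs size_le T_smooth *.
  split; first by move=> c p x [j]; rewrite onth0n.
  by exists 0; rewrite // addn0; apply: weight_of_length.
rewrite FE_cons in T_smooth *.
have [||||T_letters [U U_len U_le]] := IHT.
- by move=> d [j Tj]; apply: cs; exists j.+1.
- by move=> L R t [j Tj]; apply: rs; exists j.+1.
- by move=> d [j Tj]; apply: size_le; exists j.+1.
- move=> k /andP[k_gt0 k_le]; rewrite -(takel_cat c)//.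
  by apply: T_smooth; rewrite k_gt0 size_cat (leq_trans k_le) ?leq_addr.
have cT : column (c :: T) c by exists 0.
have [||c_letters c_len c_le] := column_length (cs c cT) _ U_len _ (size_le c cT).
- move=> k /andP[k_gt0 k_le]; have := T_smooth (size (FE T) + k).
  rewrite take_cat (ltnNge _ (size (FE T))) leq_addr /= addKn /add_letters foldl_cat; apply.
  by rewrite size_cat; lia.
(* For an empty tail the default column [[::]] forces [U = 0]. *)
- case: T U_le rs {IHT T_letters T_smooth cs size_le cT U_len} => [|R T] /=.
    by rewrite leqn0 => /eqP ->.
  by move=> U_le rs; apply: leq_trans U_le _; apply: rs; exists 0.
split; last by exists (nbelow c n); rewrite // /add_letters foldl_cat.
move=> d p x [[|j] /=]; first by case=> <-; apply: c_letters.
by move=> Tj; apply: T_letters; exists j.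
Qed.

(** * Shapes, rows and adjacent columns *)

Lemma shape_size n (nu : young n) (T : tableau n) j c :
  has_shape nu T -> onth T j = Some c -> size c = count (fun x => j < x) nu.
Proof.
move=> Tnu Tj; have j_lt : j < size T by rewrite -onthTE Tj.
have := congr1 size Tnu; rewrite !size_map size_iota => size_T.
have := congr1 (fun s => nth 0 s j) Tnu.
rewrite (nth_map [::])// (onth_nth [::] _ _ _ Tj) => ->.
by rewrite (nth_map 0) ?size_iota -?size_T// nth_iota -?size_T.
Qed.

Lemma tab_row_adjacent n (T : tableau n) L R i x y :
  sorted (@lel n) (tab_row T i) -> adjacent T L R ->
  entry L i x -> entry R i y -> rank x <= rank y.
Proof.
rewrite /entry => row_sorted [j [TL TR]] Lx Ry.
elim: T j TL TR row_sorted => [|c T IHT] j; first by rewrite onth0n.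
case: j => [|j] /=.
  move=> [->]; case: T {IHT} => [|d T] //= [->] .
  by rewrite /tab_row /= Lx Ry /= => /andP[].
move=> TL TR; rewrite /tab_row /=; case: (onth c i) => [z|] /=.
  by move/path_sorted; apply: IHT TL TR.
exact: IHT TL TR.
Qed.

(** The last letter of [R] that is counted has a left neighbour, as [L] is at least as long; that
    neighbour has no larger rank, so it is counted too. *)
Lemma nbelow_adjacent n (nu : young n) (T : tableau n) :
  has_shape nu T -> (forall i, sorted (@lel n) (tab_row T i)) ->
  (forall c, column T c -> sorted (@lel n) c) ->
  forall L R t, adjacent T L R -> nbelow R t <= nbelow L t.
Proof.
move=> Tnu row_sorted cs L R t LR; have [j [TL TR]] := LR.
have sizeRL : size R <= size L.
  rewrite (shape_size Tnu TL) (shape_size Tnu TR).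
  by apply: sub_count => z /=; apply: ltnW.
have Ls : sorted (@lel n) L by apply: cs; exists j.
have Rs : sorted (@lel n) R by apply: cs; exists j.+1.
have [->//|R_gt0] := posnP (nbelow R t).
have R_le := nbelow_size R t.
have [|y Ry] := @entry_exists _ R (nbelow R t).-1; first by lia.
have [|x Lx] := @entry_exists _ L (nbelow R t).-1; first by lia.
have := tab_row_adjacent (row_sorted _) LR Lx Ry.
have := ltn_rank_entry t Ls Lx; have := ltn_rank_entry t Rs Ry; lia.
Qed.

Lemma all_entry n (P : pred (letter n)) (c : seq (letter n)) :
  (forall p x, entry c p x -> P x) -> all P c.
Proof.
rewrite /entry; elim: c => //= x c IHc cP; rewrite (cP 0)//=.
by apply: IHc => p y; apply: (cP p.+1).
Qed.

Lemma tab_row_nonzero n (T : tableau n) i :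
  (forall c, column T c -> all (fun x => ~~ is_zero x) c) ->
  count (@is_zero n) (tab_row T i) = 0.
Proof.
elim: T => //= c T IHT T0; rewrite /tab_row /=.
have {}IHT : count (@is_zero n) (tab_row T i) = 0.
  by apply: IHT => d [j Tj]; apply: T0; exists j.+1.
case ci: (onth c i) => [x|] //=; rewrite IHT.
have /(all_nthP x)/(_ i) : all (fun x => ~~ is_zero x) c by apply: T0; exists 0.
by rewrite -onthTE ci (onth_nth x _ _ _ ci) => /(_ isT)/negbTE ->.
Qed.

(** These are the two ranks that smoothness excludes, so [v] alone makes [B3] and [B4] vacuous. *)
Lemma central_pair_rank n (u v : letter n) :
  central_pair u v -> n <= rank v <= n.+1.
Proof. by case=> k [kn [] [_ ->]] /=; lia. Qed.

Theorem theorem9p2 (n : nat) (la mu nu : young n)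
    (h : (ell mu + ell nu <= n)%N) :
  B_so_smooth nu mu la = B_sp_smooth nu mu la.
Proof.
have letters T : has_shape nu T -> (forall i, sorted (@lel n) (tab_row T i)) ->
    (forall c, column T c -> sorted (@lel n) c) -> smooth mu (FE T) ->
    forall c p x, column T c -> entry c p x -> rank x < n \/ n.+1 < rank x.
  move=> Tnu rs cs; apply: smooth_letters => //.
    exact: nbelow_adjacent Tnu rs cs.
  move=> c [j Tj]; apply: leq_trans h; rewrite leq_add2l (shape_size Tnu Tj).
  by apply: sub_count => x /=; apply: leq_ltn_trans.
have nonzero T : (forall c p x, column T c -> entry c p x ->
      rank x < n \/ n.+1 < rank x) ->
    forall c, column T c -> all (fun x : letter n => ~~ is_zero x) c.
  move=> lettersT c cT; apply: all_entry => p [i||i] // e.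
  by have := lettersT _ _ _ cT e; rewrite /=; lia.
apply/seteqP; split=> T [[Tnu ss adm] T_smooth T_la]; split=> //.
- case: ss adm => rs _ cs [b1 b2 _ _].
  have cs_weak c : column T c -> sorted (@lel n) c.
    move=> /cs; apply: sub_sorted => x y /orP[/ltnW//|].
    by case: x y => [i||i] [j||j] //= _; apply: leqnn.
  have lettersT := letters T Tnu rs cs_weak T_smooth.
  have cs_strict c : column T c -> sorted (@ltl n) c.
    move=> cT; have := cs c cT; apply: sub_in_sorted (nonzero T lettersT c cT).
    by move=> x y; rewrite -!topredE /= => /negbTE -> _; rewrite orbF.
  split=> //; first by split=> //; apply: nonzero.
  split; first exact: C1_of_B1.
  apply: C2_of_B2 => //; first exact: nbelow_adjacent Tnu rs cs_weak.
  move=> c p b cT /(lettersT _ _ _ cT) /=.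
  by have := ltn_ord b; lia.
case: ss adm => _ rs cs [c1 c2].
have lettersT := letters T Tnu rs (fun c cT => ltl_lel_sorted (cs c cT)) T_smooth.
split=> //; [split=> //|split].
- by move=> i; rewrite tab_row_nonzero//; apply: nonzero.
- by move=> c /cs; apply: sub_sorted => x y ->.
- by move=> c i p q cT ep eq; have := c1 _ _ _ _ _ cT ep eq; rewrite maxnn.
- move=> L R p q r s a b LR pq qr rs' ab bn cfg.
  by have := c2 _ _ _ _ _ _ _ _ _ _ LR pq qr rs' ab ab cfg; rewrite maxnn minnn.
- move=> L R p q r s a u v [j [TL TR]] _ _ _ _ /central_pair_rank v_rank.
  case/config_middle => M ML [_ _ Mv _].
  suff /lettersT/(_ Mv) : column T M by lia.
  by case: ML => ->; [exists j|exists j.+1].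
- move=> L R p s u v [j [TL TR]] _ /central_pair_rank v_rank [_ Rv].
  have /lettersT/(_ Rv) : column T R by exists j.+1.
  by lia.
Qed.
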